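(* Let $A$ be a non-zero positive bounded operator on a complex Hilbert space $\mathscr{H}$ and let $T\in\mathbb{B}_A(\mathscr{H})$. Then $$\frac14\|T^\sharp T+TT^\sharp\|_A+\frac{\alpha}{2}\max\{\|\Re_A(T)\|_A,\|\Im_A(T)\|_A\}\le w_A^2(T)\le\frac12\|TT^\sharp+T^\sharp T\|_A,$$ where $\alpha=\big|\,\|\Re_A(T)+\Im_A(T)\|_A-\|\Re_A(T)-\Im_A(T)\|_A\big|$.
   Context: $\mathbb{B}(\mathscr{H})$ is the algebra of bounded linear operators on $\mathscr{H}$. For $x,y\in\mathscr{H}$, $\langle x,y\rangle_A=\langle Ax,y\rangle$ and $\|x\|_A=\langle Ax,x\rangle^{1/2}$. $\mathbb{B}_A(\mathscr{H})$ is the set of $T\in\mathbb{B}(\mathscr{H})$ for which there is $S\in\mathbb{B}(\mathscr{H})$ with $AS=T^*A$. For $T\in\mathbb{B}_A(\mathscr{H})$, $T^\sharp$ is the unique solution $X\in\mathbb{B}(\mathscr{H})$ of $AX=T^*A$ whose range is contained in $\overline{\mathcal{R}(A)}$. Put $\Re_A(T)=\frac12(T+T^\sharp)$ and $\Im_A(T)=\frac1{2i}(T-T^\sharp)$. The $A$-operator seminorm is $\|T\|_A=\sup\{\|Tx\|_A:\|x\|_A=1\}$ (finite for $T\in\mathbb{B}_A(\mathscr{H})$), and the $A$-numerical radius is $w_A(T)=\sup\{|\langle Tx,x\rangle_A|:\|x\|_A=1\}$; $w_A^2(T)$ means $(w_A(T))^2$. *)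

(* Defs.v *)
From HB Require Import structures.
From mathcomp Require Import all_boot all_order all_algebra sesquilinear.
From mathcomp Require Import complex.
From mathcomp Require Import all_classical all_reals all_analysis.

Set Implicit Arguments.
Unset Strict Implicit.
Unset Printing Implicit Defensive.

Import Order.TTheory GRing.Theory Num.Theory Num.Def.
Import numFieldNormedType.Exports.

Local Open Scope classical_set_scope.
Local Open Scope ring_scope.
Local Open Scope complex_scope.

(* A complex Hilbert space is a complete normed space over [R[i]] whose norm
   is the one of an inner product.  The forms of type [{dot H for conjC}] are
   positive definite, linear on the left and conjugate-linear on the right. *)
Definition is_hilbert (R : realType) (H : completeNormedModType R[i])
    (dot : {dot H for conjC}) : Prop :=
  forall x : H, `|x| = sqrtC (dot x x).

Definition bounded_operator (R : realType) (H : completeNormedModType R[i])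
    (T : H -> H) : Prop :=
  linear T /\ exists M : R, forall x : H, `|T x| <= M%:C * `|x|.

Section SemiHilbert.
Context (R : realType) (H : completeNormedModType R[i]).
Context (dot : {dot H for conjC}).

Local Notation "''[' u , v ]" := (dot u v) : ring_scope.

(* In [R[i]], [0 <= z] says that [z] is a nonnegative real number. *)
Definition positive_operator (A : H -> H) : Prop :=
  bounded_operator A /\ forall x : H, 0 <= '[A x, x].

(* The Hilbert adjoint T^*; the default value 0 is never reached when [T] is
   bounded and [is_hilbert dot] holds. *)
Definition adjoint (T : H -> H) : H -> H :=
  xget (0 : H -> H)
    [set S : H -> H | bounded_operator S /\
                      forall x y : H, '[T x, y] = '[x, S y]].

Variable A : H -> H.

Definition dotA (x y : H) : R[i] := '[A x, y].

(* For positive [A], [dotA x x] is real, so taking its real part only changes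
   the type from [R[i]] to [R]; likewise for the modulus in [numradiusA]. *)
Definition normA (x : H) : R := Num.sqrt (complex.Re (dotA x x)).

Definition in_BA (T : H -> H) : Prop :=
  bounded_operator T /\
  exists S : H -> H, bounded_operator S /\ A \o S = adjoint T \o A.

(* T^sharp; the default value 0 is never reached when [T] is in [in_BA]. *)
Definition sharp (T : H -> H) : H -> H :=
  xget (0 : H -> H)
    [set X : H -> H | [/\ bounded_operator X,
                          A \o X = adjoint T \o A &
                          range X `<=` closure (range A)]].

Definition ReA (T : H -> H) : H -> H := 2^-1 *: (T + sharp T).

Definition ImA (T : H -> H) : H -> H := (2 * 'i)^-1 *: (T - sharp T).

(* [sup] is the supremum in [R], which is meaningful on non-empty bounded sets
   only: the two sets below are such when [A] is a non-zero positive operator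
   and [T] is in [in_BA]. *)
Definition opnormA (T : H -> H) : R :=
  sup [set normA (T x) | x in [set x : H | normA x = 1]].

Definition numradiusA (T : H -> H) : R :=
  sup [set complex.Re `|dotA (T x) x| | x in [set x : H | normA x = 1]].

End SemiHilbert.

(* Main.v *)
Require Import Defs.
From HB Require Import structures.
From mathcomp Require Import all_boot all_order all_algebra sesquilinear.
From mathcomp Require Import complex.
From mathcomp Require Import all_classical all_reals all_analysis.
From mathcomp Require Import ring lra.

Set Implicit Arguments.
Unset Strict Implicit.
Unset Printing Implicit Defensive.

Import Order.TTheory GRing.Theory Num.Theory Num.Def.
Import numFieldNormedType.Exports.

Local Open Scope classical_set_scope.
Local Open Scope ring_scope.
Local Open Scope complex_scope.

(* Write P and Q for the A-real and A-imaginary parts of T; they are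
   selfadjoint for the semi-inner product <x, y>_A, and
   |<Tx, x>_A|^2 = <Px, x>_A^2 + <Qx, x>_A^2.  Since
   (T T# + T# T) / 2 = P^2 + Q^2 = ((P + Q)^2 + (P - Q)^2) / 2, Cauchy-Schwarz
   gives the upper bound.  For the lower bound put a = ||P + Q||_A and
   b = ||P - Q||_A.  The A-seminorm of a selfadjoint operator is its A-numerical
   radius, so a^2 and b^2 are at most 2 w_A(T)^2, while
   ||T T# + T# T||_A <= a^2 + b^2 and max(||P||_A, ||Q||_A) <= (a + b) / 2.
   The left-hand side is therefore at most
   (a^2 + b^2) / 4 + |a^2 - b^2| / 4 = max(a, b)^2 / 2.
   T# is the projection onto the closure of the range of A applied to any
   solution S; adjoint and projection both come from a Riesz theorem on
   subspaces, where |x|^2 - 2 Re (f x) is minimised. *)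

(** * Elementary real inequalities *)

(** If [a > M > 0], Bernoulli's inequality makes [(a / M) ^+ n] grow at least linearly, against the
    fixed bound [c]. For [M = 0] the case [n = 1] suffices. *)
Lemma expr_dominated_le (R : realType) (a M c : R) : 0 <= M ->
  (forall n, a ^+ n <= c * M ^+ n) -> a <= M.
Proof.
move=> M0 H; rewrite leNgt; apply/negP => Ma.
have a0 : 0 < a by exact: le_lt_trans Ma.
have [M_eq0|M_neq0] := eqVneq M 0; first last.
  have Mgt0 : 0 < M by rewrite lt_def M_neq0.
  pose q := a / M - 1.
  have q0 : 0 < q by rewrite subr_gt0 ltr_pdivlMr// mul1r.
  have bern n : 1 + n%:R * q <= (a / M) ^+ n.
    elim: n => [|n IH]; first by rewrite mul0r addr0 expr0.
    rewrite exprS; apply: (@le_trans _ _ ((1 + q) * (1 + n%:R * q))).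
      rewrite -natr1; have : 0 <= n%:R * q ^+ 2 :> R by rewrite mulr_ge0// sqr_ge0.
      nra.
    have -> : 1 + q = a / M by rewrite /q addrC subrK.
    by rewrite ler_wpM2l// divr_ge0// ltW.
  have cub n : 1 + n%:R * q <= c.
    apply: le_trans (bern n) _.
    by rewrite expr_div_n ler_pdivrMr ?exprn_gt0.
  (* This index exceeds [c / q], so [1 + n * q] exceeds [c]. *)
  have := cub (truncn (c / q)).+1.
  rewrite leNgt => /negP; apply.
  have : c / q < (truncn (c / q)).+1%:R.
    have [c0|c0] := leP 0 (c / q); first by rewrite truncnS_gt.
    by apply: lt_trans c0 _; rewrite ltr0n.
  rewrite ltr_pdivrMr//; lra.
by have := H 1%N; rewrite !expr1 M_eq0 mulr0 leNgt a0.
Qed.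

Lemma quadratic_ge0_discr (R : realFieldType) (a b c : R) :
  (forall t, 0 <= a + 2 * t * b + t ^+ 2 * c) -> 0 <= c -> b ^+ 2 <= a * c.
Proof.
move=> H c0; have a0 : 0 <= a by have := H 0; rewrite expr0n mulr0 !mul0r !addr0.
have [cz|cz] := eqVneq c 0.
  have [->|bz] := eqVneq b 0; first by rewrite expr0n mulr_ge0.
  (* With [c = 0] the polynomial is affine; this [t] gives it the value -1. *)
  have := H (- (a + 1) / (2 * b)).
  have -> : 2 * (- (a + 1) / (2 * b)) * b = - (a + 1) by field.
  by rewrite cz; lra.
have cpos : 0 < c by rewrite lt_def cz.
have := H (- b / c).
have -> : a + 2 * (- b / c) * b + (- b / c) ^+ 2 * c = (a * c - b ^+ 2) / c.
  by field.
by rewrite pmulr_lge0 ?invr_gt0// subr_ge0.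
Qed.

(** * Real semi-inner products and their selfadjoint maps *)

Section RealSemiInner.
Context (R : realType) (V : lmodType R[i]).

(** Only scalars [a%:C] appear, so that real parts of sesquilinear forms qualify; semidefiniteness
    leaves room for the kernel of [A]. *)
Definition real_semi_inner (r : V -> V -> R) : Prop :=
  [/\ forall x y z, r (x + y) z = r x z + r y z,
      forall (a : R) x y, r (a%:C *: x) y = a * r x y,
      forall x y, r x y = r y x &
      forall x, 0 <= r x x].

Definition semi_norm (r : V -> V -> R) (x : V) : R := Num.sqrt (r x x).

Context (r : V -> V -> R) (hr : real_semi_inner r).

Local Notation nr := (semi_norm r).

Lemma siDl x y z : r (x + y) z = r x z + r y z.
Proof. by case: hr. Qed.

Lemma siZl (a : R) x y : r (a%:C *: x) y = a * r x y.
Proof. by case: hr. Qed.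

Lemma siC x y : r x y = r y x.
Proof. by case: hr. Qed.

Lemma si_ge0 x : 0 <= r x x.
Proof. by case: hr. Qed.

Lemma siDr x y z : r x (y + z) = r x y + r x z.
Proof. by rewrite siC siDl !(siC x). Qed.

Lemma siZr (a : R) x y : r x (a%:C *: y) = a * r x y.
Proof. by rewrite siC siZl (siC x). Qed.

Lemma siNl x y : r (- x) y = - r x y.
Proof.
by rewrite -scaleN1r -[- 1](rmorphN1 (real_complex R)) siZl mulN1r.
Qed.

Lemma siNr x y : r x (- y) = - r x y.
Proof. by rewrite siC siNl siC. Qed.

Definition siE := (siDl, siDr, siNl, siNr, siZl, siZr).

Lemma semi_norm_ge0 x : 0 <= nr x.
Proof. exact: sqrtr_ge0. Qed.

Lemma sqr_semi_norm x : nr x ^+ 2 = r x x.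
Proof. exact/sqr_sqrtr/si_ge0. Qed.

Lemma semi_normZ (a : R) x : nr (a%:C *: x) = `|a| * nr x.
Proof.
by rewrite /semi_norm !siE mulrA -expr2 sqrtrM ?sqr_ge0// sqrtr_sqr.
Qed.

Lemma si_CauchySchwarz x y : r x y ^+ 2 <= r x x * r y y.
Proof.
have y0 := si_ge0 y; have H (t : R) : 0 <= r x x + 2 * t * r x y + t ^+ 2 * r y y.
  by have := si_ge0 (x + t%:C *: y); rewrite !siE (siC y x); nra.
exact: quadratic_ge0_discr H y0.
Qed.

Lemma ler_abs_si x y : `|r x y| <= nr x * nr y.
Proof.
by rewrite -sqrtr_sqr /semi_norm -sqrtrM ?si_ge0// ler_wsqrtr// si_CauchySchwarz.
Qed.

Lemma ler_si x y : r x y <= nr x * nr y.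
Proof. exact: le_trans (ler_norm _) (ler_abs_si x y). Qed.

Lemma ler_semi_normD x y : nr (x + y) <= nr x + nr y.
Proof.
have x0 := semi_norm_ge0 x; have y0 := semi_norm_ge0 y.
rewrite -ler_sqr ?nnegrE ?addr_ge0 ?semi_norm_ge0//.
rewrite sqrrD !sqr_semi_norm !siE (siC y x).
by have := ler_si x y; lra.
Qed.

Lemma semi_normN x : nr (- x) = nr x.
Proof. by rewrite /semi_norm !siE opprK. Qed.

Lemma semi_norm_half_sum x y : nr x <= (nr (x + y) + nr (x - y)) / 2.
Proof.
have := ler_semi_normD (x + y) (x - y).
have -> : x + y + (x - y) = 2%:C *: x.
  by rewrite addrACA subrr addr0 rmorph_nat scaler_nat mulr2n.
by rewrite semi_normZ ger0_norm//; lra.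
Qed.

Definition si_selfadjoint (S : V -> V) : Prop :=
  forall x y, r (S x) y = r x (S y).

Lemma si_selfadjointD S x y z : si_selfadjoint S ->
  r (S (x + y)) z = r (S x) z + r (S y) z.
Proof. by move=> hS; rewrite !hS siDl. Qed.

Lemma si_selfadjointZ S (a : R) x z : si_selfadjoint S ->
  r (S (a%:C *: x)) z = a * r (S x) z.
Proof. by move=> hS; rewrite !hS siZl. Qed.

(** Both sides are homogeneous of degree 2; where the seminorm vanishes, Cauchy-Schwarz makes both
    zero. *)
Lemma unit_quadratic_le S (k : R) : si_selfadjoint S ->
  (forall x, nr x = 1 -> `|r (S x) x| <= k) ->
  forall x, `|r (S x) x| <= k * r x x.
Proof.
move=> hS H x; have [x0|x0] := eqVneq (nr x) 0.
  have := ler_abs_si (S x) x; rewrite x0 mulr0 => /le_trans; apply.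
  by rewrite -sqr_semi_norm x0 expr0n mulr0.
have xpos : 0 < nr x by rewrite lt_def x0 semi_norm_ge0.
have /H : nr ((nr x)^-1%:C *: x) = 1.
  by rewrite semi_normZ ger0_norm ?invr_ge0 ?semi_norm_ge0// mulVf.
rewrite si_selfadjointZ// siZr mulrA -expr2 normrM ger0_norm ?sqr_ge0//.
by rewrite exprVn sqr_semi_norm mulrC ler_pdivrMr// -sqr_semi_norm exprn_gt0.
Qed.

(* Polarization: [4 r (S x) y] is the difference of the quadratic form at
   [x + y] and at [x - y], tested at [y = S x / |S x|]. *)
Lemma selfadjoint_norm_le S (k : R) : si_selfadjoint S ->
  (forall x, nr x = 1 -> `|r (S x) x| <= k) ->
  forall x, nr x = 1 -> nr (S x) <= k.
Proof.
move=> hS H x x1; have Hq := unit_quadratic_le hS H.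
have k0 : 0 <= k by apply: le_trans (H x x1).
have [->//|s0] := eqVneq (nr (S x)) 0.
have spos : 0 < nr (S x) by rewrite lt_def s0 semi_norm_ge0.
pose y := (nr (S x))^-1%:C *: S x.
have yy : r y y = 1.
  by rewrite /y !siE -sqr_semi_norm mulrA -expr2 exprVn mulVf ?expf_neq0.
have xx : r x x = 1 by rewrite -sqr_semi_norm x1 expr1n.
have xy : r (S x) y = nr (S x).
  by rewrite /y siZr -sqr_semi_norm expr2 mulrA mulVf ?mul1r.
have yx : r (S y) x = nr (S x) by rewrite hS siC.
clearbody y; have := Hq (x + y); have := Hq (x - y).
have SN z t : r (S (- z)) t = - r (S z) t by rewrite !hS siNl.
rewrite !(si_selfadjointD _ _ _ hS) !SN !siE xy yx xx yy (siC y x) !ler_norml.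
move=> /andP[h1 h2] /andP[h3 h4]; lra.
Qed.

(* Log-convexity of [n |-> |S^n x|] makes it grow at least like [|S x| ^+ n]. *)
Lemma selfadjoint_iter_bound S (M : R) : si_selfadjoint S -> 0 <= M ->
  (forall x, exists c, forall n, nr (iter n S x) <= c * M ^+ n) ->
  forall x, nr x = 1 -> nr (S x) <= M.
Proof.
move=> hS M0 H x x1; have [c hc] := H x.
apply: (@expr_dominated_le _ _ _ c M0) => n; apply: le_trans (hc n).
have [s0|s0] := eqVneq (nr (S x)) 0.
  rewrite s0; case: n => [|n]; first by rewrite expr0 /= x1.
  by rewrite expr0n semi_norm_ge0.
have spos : 0 < nr (S x) by rewrite lt_def s0 semi_norm_ge0.
have step m : 0 < nr (iter m S x) /\
    nr (S x) * nr (iter m S x) <= nr (iter m.+1 S x).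
  elim: m => [|m [IH0 IH1]]; first by rewrite /= x1 mulr1 ltr01.
  have pos1 : 0 < nr (iter m.+1 S x).
    by apply: lt_le_trans IH1; rewrite mulr_gt0.
  split=> //; rewrite -(ler_pM2l IH0).
  apply: (@le_trans _ _ (nr (iter m.+1 S x) ^+ 2)); first by nra.
  (* Moving one [S] across, |S^(m+1) x|^2 = r (S^m x) (S^(m+2) x), and Cauchy-Schwarz applies. *)
  by rewrite sqr_semi_norm {1}iterS hS ler_si.
elim: n => [|n IH]; first by rewrite expr0 /= x1.
rewrite exprS; apply: le_trans (step n).2.
by rewrite ler_wpM2l// semi_norm_ge0.
Qed.

(** * Near-minimizers of [r x x - 2 * phi x] on a subspace *)

Section QuadraticFunctional.
Context (M : set V) (phi : V -> R) (d : R).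
Context (MD : forall x y, M x -> M y -> M (x + y)).
Context (MZ : forall (a : R) x, M x -> M (a%:C *: x)).
Context (phiD : forall x y, phi (x + y) = phi x + phi y).
Context (phiZ : forall (a : R) x, phi (a%:C *: x) = a * phi x).
Context (dle : forall x, M x -> d <= r x x - 2 * phi x).

(** Parallelogram law: the midpoint lies in [M], hence has value at least [d], and the [phi] terms
    cancel. *)
Lemma almost_minimizer_close x y (e e' : R) : M x -> M y ->
  r x x - 2 * phi x <= d + e -> r y y - 2 * phi y <= d + e' ->
  r (x - y) (x - y) <= 2 * (e + e').
Proof.
move=> Mx My hx hy.
have := dle (MZ 2^-1 (MD Mx My)).
by rewrite phiZ phiD !siE (siC y x); lra.
Qed.

(** The value at [x + t h] is at least [d] for all [t]; the discriminant of this quadratic in [t]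
    gives the bound. *)
Lemma almost_minimizer_stationary x h (e : R) : M x -> M h ->
  r x x - 2 * phi x <= d + e -> (r h x - phi h) ^+ 2 <= e * r h h.
Proof.
move=> Mx Mh hx; apply: quadratic_ge0_discr (si_ge0 h) => t.
by have := dle (MD Mx (MZ t Mh)); rewrite phiD phiZ !siE (siC x h); nra.
Qed.

End QuadraticFunctional.

End RealSemiInner.

(** * The form of a positive operator, and the Hilbert norm in real terms *)

Section HilbertForm.
Context (R : realType) (H : completeNormedModType R[i]).
Context (dot : {dot H for conjC}).

Lemma linear_funD (T : H -> H) x y : linear T -> T (x + y) = T x + T y.
Proof. by move=> hT; have := hT 1 x y; rewrite !scale1r. Qed.

Lemma linear_fun0 (T : H -> H) : linear T -> T 0 = 0.
Proof. by move=> hT; have := hT (-1) 0 0; rewrite !scaleN1r oppr0 addr0 addNr. Qed.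

Lemma linear_funZ (T : H -> H) a x : linear T -> T (a *: x) = a *: T x.
Proof. by move=> hT; have := hT a x 0; rewrite !addr0 linear_fun0// addr0. Qed.

Lemma linear_funN (T : H -> H) x : linear T -> T (- x) = - T x.
Proof. by move=> hT; rewrite -scaleN1r linear_funZ// scaleN1r. Qed.

Section PositiveForm.
Context (A : H -> H) (Alin : linear A) (Apos : forall x, 0 <= dot (A x) x).

Local Notation dA := (dotA dot A).

Lemma dotADl x y z : dA (x + y) z = dA x z + dA y z.
Proof. by rewrite /dotA linear_funD// linearDl. Qed.

Lemma dotADr x y z : dA x (y + z) = dA x y + dA x z.
Proof. by rewrite /dotA linearDr. Qed.

Lemma dotAZl a x y : dA (a *: x) y = a * dA x y.
Proof. by rewrite /dotA linear_funZ// linearZl_LR. Qed.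

Lemma dotAZr a x y : dA x (a *: y) = a^* * dA x y.
Proof. by rewrite /dotA linearZr_LR. Qed.

Lemma dotANl x y : dA (- x) y = - dA x y.
Proof. by rewrite -scaleN1r dotAZl mulN1r. Qed.

(* A sesquilinear form with real diagonal is Hermitian. *)
Lemma dotA_herm x y : dA y x = (dA x y)^*%C.
Proof.
have D z : complex.Im (dA z z) = 0 by rewrite ger0_Im//; exact: Apos.
(* [x + y] compares the imaginary parts of the two values, [x + i y] their real parts. *)
have := D (x + y); have := D (x + 'i%C *: y).
rewrite !(dotADl, dotADr, dotAZl, dotAZr) /= !raddfD /= !D.
have := D y.
case: (dA x y) => a b; case: (dA y x) => c d; case: (dA y y) => e f /= ->.
move=> h1 h2; congr Complex; nra.
Qed.

Definition rdotA x y : R := complex.Re (dA x y).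

Lemma rdotA_semi_inner : real_semi_inner rdotA.
Proof.
split=> [x y z|a x y|x y|x]; rewrite /rdotA.
- by rewrite dotADl raddfD.
- by rewrite dotAZl; case: (dA x y) => u v /=; rewrite mul0r subr0.
- by rewrite dotA_herm; case: (dA y x).
- by have := Apos x; rewrite -/(dA x x) lecE => /andP[].
Qed.

(** Recovers the complex form from its real part, so that real arguments settle complex
    identities. *)
Lemma Im_dotA x y : complex.Im (dA x y) = rdotA x ('i%C *: y).
Proof.
rewrite /rdotA dotAZr; case: (dA x y) => u v /=.
by rewrite mul0r add0r mulN1r opprK.
Qed.

Lemma dotA_diag x : dA x x = (rdotA x x)%:C.
Proof.
rewrite /rdotA; have : complex.Im (dA x x) = 0 by rewrite ger0_Im//; exact: Apos.
by case: (dA x x) => u v /= ->.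
Qed.

End PositiveForm.

(** Taking [idfun] for [A] makes the lemmas on [dotA] apply to the inner product itself. *)
Local Notation rdot := (rdotA idfun).
Local Notation nrm := (semi_norm rdot).

Lemma idfun_linear : linear (idfun : H -> H).
Proof. by []. Qed.

Lemma dot_ge0 (x : H) : 0 <= dot (idfun x) x.
Proof. exact: dnorm_ge0. Qed.

Lemma rdot_semi_inner : real_semi_inner rdot.
Proof. exact: rdotA_semi_inner idfun_linear dot_ge0. Qed.

Lemma dotC x y : dot y x = (dot x y)^*%C.
Proof. exact: dotA_herm idfun_linear dot_ge0 x y. Qed.

Lemma dot_injl u v : (forall h, dot h u = dot h v) -> u = v.
Proof.
move=> huv; apply/eqP; rewrite -subr_eq0 -(dnorm_eq0 dot).
by rewrite linearBr /= !huv subrr.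
Qed.

Context (hH : is_hilbert dot).

Lemma hilbert_norm x : `|x| = (nrm x)%:C.
Proof.
rewrite hH; have -> : dot x x = (nrm x)%:C ^+ 2.
  rewrite -rmorphXn /= (sqr_semi_norm rdot_semi_inner).
  exact: (dotA_diag dot_ge0).
by rewrite sqrCK// ler0c semi_norm_ge0.
Qed.

Lemma hilbert_boundedP (T : H -> H) : bounded_operator T ->
  exists2 M : R, 0 <= M & forall x, nrm (T x) <= M * nrm x.
Proof.
case=> _ [M hM]; exists (Num.max M 0); first by rewrite le_max lexx orbT.
move=> x; have := hM x; rewrite !hilbert_norm -rmorphM /= lecR => /le_trans; apply.
by rewrite ler_wpM2r ?semi_norm_ge0// le_max lexx.
Qed.

Lemma hilbert_bounded (T : H -> H) (M : R) : linear T ->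
  (forall x, nrm (T x) <= M * nrm x) -> bounded_operator T.
Proof.
move=> hT hM; split=> //; exists M => x.
by rewrite !hilbert_norm -rmorphM /= lecR.
Qed.

Lemma hilbert_complete (x : nat -> H) :
  (forall e : R, 0 < e -> exists N, forall n, (N <= n)%N -> nrm (x N - x n) < e) ->
  exists z, forall e : R, 0 < e ->
    exists N, forall n, (N <= n)%N -> nrm (z - x n) < e.
Proof.
move=> hx.
(* Radii of balls live in [R[i]], where being positive entails being real. *)
have epos (e : R[i]) : 0 < e -> 0 < complex.Re e /\ e = (complex.Re e)%:C.
  by rewrite ltcE => /andP[/eqP]; case: e => a b /= -> ->.
have cx : cvg (x @ \oo).
  apply/cauchy_cvgP/cauchyP => e /epos[e0 ->].
  have [N hN] := hx _ e0; exists (x N); exists N => // n /= Nn.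
  by rewrite -ball_normE /= hilbert_norm ltcR; exact: hN.
exists (lim (x @ \oo)) => e e0.
have /cvgrPdist_lt/(_ e%:C) : x @ \oo --> lim (x @ \oo) by [].
rewrite ltcR => /(_ e0)[N _ hN]; exists N => n /hN /=.
by rewrite hilbert_norm ltcR.
Qed.

Lemma hilbert_closureP (M : set H) z : closure M z <->
  (forall e : R, 0 < e -> exists2 m, M m & nrm (z - m) < e).
Proof.
split=> [cM e e0|hM B].
  have [m [Mm]] := cM (ball z e%:C) (nbhsx_ballx z (e%:C) ltac:(by rewrite ltcR)).
  by rewrite -ball_normE /= hilbert_norm ltcR; exists m.
move=> /nbhs_ballP[e /= e0 he].
have [e1 ee] : 0 < complex.Re e /\ e = (complex.Re e)%:C.
  by move: e0; rewrite ltcE => /andP[/eqP]; case: (e) => a b /= -> ->.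
have [m Mm hm] := hM _ e1; exists m; split=> //; apply: he.
by rewrite -ball_normE /= ee hilbert_norm ltcR.
Qed.

End HilbertForm.

(** * Riesz representation on subspaces and relative adjoints *)

Section Riesz.
Context (R : realType) (H : completeNormedModType R[i]).
Context (dot : {dot H for conjC}) (hH : is_hilbert dot).

Local Notation rdot := (rdotA dot idfun).
Local Notation nrm := (semi_norm rdot).

Let rsi : real_semi_inner rdot := rdot_semi_inner dot.

Lemma harmonic_lt (e : R) : 0 < e ->
  exists N, forall n, (N <= n)%N -> n.+1%:R^-1 < e.
Proof.
move=> e0; exists (truncn e^-1) => n Nn.
by rewrite invf_plt ?posrE// (lt_le_trans (truncnS_gt _))// ler_nat.
Qed.

Lemma eq0_le_eps (g k : R) : (forall e, 0 < e -> `|g| <= e * k) -> g = 0.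
Proof.
move=> hg; apply/eqP; rewrite -normr_eq0 -[_ == 0]negbK; apply/negP => g0.
have {g0} gpos : 0 < `|g| by rewrite lt_def g0 normr_ge0.
(* Here e = |g| / (1 + |k|), which would force 1 + |k| <= k. *)
have := hg _ (divr_gt0 gpos (ltr_pwDl ltr01 (normr_ge0 k))).
have k1 : 0 < 1 + `|k| by rewrite ltr_pwDl.
rewrite -mulrA ler_pMr// mulrC ler_pdivlMr// mul1r.
by have := ler_norm k; lra.
Qed.

Section RealRiesz.
Context (M : set H) (phi : H -> R) (C : R) (M0 : M 0).
Context (MD : forall x y, M x -> M y -> M (x + y)).
Context (MZ : forall (a : R) x, M x -> M (a%:C *: x)).
Context (phiD : forall x y, phi (x + y) = phi x + phi y).
Context (phiZ : forall (a : R) x, phi (a%:C *: x) = a * phi x).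
Context (phiC : forall x, phi x <= C * nrm x).

(** A minimizing sequence is Cauchy and its limit represents [phi]; the limit lies only in the
    closure, as [M] may fail to be closed. *)
Lemma real_riesz : exists2 z, closure M z & forall h, M h -> phi h = rdot h z.
Proof.
pose J x := rdot x x - 2 * phi x.
pose d := inf [set J x | x in M].
(* Completing the square: |x|^2 - 2 C |x| >= - C^2. *)
have lbJ : lbound [set J x | x in M] (- C ^+ 2).
  move=> _ [x _ <-]; rewrite /J -(sqr_semi_norm rsi).
  have := phiC x; have := sqr_ge0 (nrm x - C); nra.
have infJ : has_inf [set J x | x in M].
  by split; [exists (J 0); exists 0|exists (- C ^+ 2)].
have dle x : M x -> d <= J x.
  by move=> Mx; apply: ge_inf; [exists (- C ^+ 2)|exists x].
have /choice[x hx] n : exists x, M x /\ J x <= d + n.+1%:R^-1.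
  have e0 : 0 < n.+1%:R^-1 :> R by rewrite invr_gt0 ltr0n.
  by have [_ [x Mx <-] hx] := inf_adherent e0 infJ; exists x; split=> //; exact: ltW.
have [e e0|z hz] := @hilbert_complete _ _ dot hH x.
  (* Two errors below e^2 / 4 give a squared distance below 2 (e^2 / 4 + e^2 / 4) = e^2. *)
  have e4 : 0 < e ^+ 2 / 4 by rewrite divr_gt0 ?exprn_gt0.
  have [N hN] := harmonic_lt e4.
  exists N => n Nn; rewrite -ltr_sqr ?nnegrE ?semi_norm_ge0 ?(ltW e0)//.
  rewrite (sqr_semi_norm rsi).
  have [MN JN] := hx N; have [Mn Jn] := hx n.
  apply: le_lt_trans (almost_minimizer_close rsi MD MZ phiD phiZ dle MN Mn JN Jn) _.
  move: (hN _ Nn) (hN _ (leqnn N)).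
  by move: n.+1%:R^-1 N.+1%:R^-1 => u v; lra.
exists z.
  apply/(hilbert_closureP hH) => e e0; have [N hN] := hz _ e0.
  by exists (x N); [exact: (hx N).1|exact: hN].
move=> h Mh; apply/eqP; rewrite eq_sym -subr_eq0; apply/eqP.
apply: (@eq0_le_eps _ (2 * nrm h)) => e e0.
have [N1 hN1] := hz _ e0; have [N2 hN2] := harmonic_lt (exprn_gt0 2 e0).
pose n := maxn N1 N2.
have l1 : nrm (z - x n) <= e by apply/ltW/hN1; rewrite leq_maxl.
have l2 : n.+1%:R^-1 <= e ^+ 2 by apply/ltW/hN2; rewrite leq_maxr.
have [Mn Jn] := hx n.
have st := almost_minimizer_stationary rsi MD MZ phiD phiZ dle Mn Mh Jn.
have h0 := semi_norm_ge0 rdot h.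
(* The first term is small since [x n] is near [z], the second by near-stationarity at [x n]. *)
have -> : rdot h z - phi h = rdot h (z - x n) + (rdot h (x n) - phi h).
  by rewrite (siDr rsi) (siNr rsi); ring.
apply: le_trans (ler_normD _ _) _.
have b1 : `|rdot h (z - x n)| <= e * nrm h.
  by apply: le_trans (ler_abs_si rsi _ _) _; rewrite mulrC ler_wpM2r.
have b2 : `|rdot h (x n) - phi h| <= e * nrm h.
  rewrite -ler_sqr ?nnegrE ?mulr_ge0 ?(ltW e0)// real_normK ?num_real//.
  apply: le_trans st _; rewrite exprMn (sqr_semi_norm rsi).
  by rewrite ler_wpM2r// (si_ge0 rsi).
lra.
Qed.

End RealRiesz.

Lemma Re_dot_i x y : complex.Re (dot ('i%C *: x) y) = - complex.Im (dot x y).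
Proof.
have -> : dot ('i%C *: x) y = 'i%C * dot x y by rewrite linearZl_LR.
by case: (dot x y) => a b /=; rewrite mul0r mul1r sub0r.
Qed.

(** The real part of [f] is represented by the real theorem; testing it at [i h] yields the
    imaginary part. *)
Lemma riesz (M : set H) (f : H -> R[i]) (C : R) : M 0 ->
  (forall x y, M x -> M y -> M (x + y)) ->
  (forall (a : R[i]) x, M x -> M (a *: x)) ->
  (forall x y, f (x + y) = f x + f y) -> (forall a x, f (a *: x) = a * f x) ->
  (forall x, complex.Re (f x) <= C * nrm x) ->
  exists2 z, closure M z & forall h, M h -> f h = dot h z.
Proof.
move=> M0 MD MZ fD fZ fC.
have [||||z Mz hz] := @real_riesz M (fun x => complex.Re (f x)) C M0 MD.
- by move=> a x; exact: MZ.
- by move=> x y; rewrite fD raddfD.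
- by move=> a x; rewrite fZ; case: (f x) => u v /=; ring.
- exact: fC.
exists z => // h Mh; have h1 := hz _ Mh; have := hz _ (MZ 'i%C _ Mh).
rewrite /rdotA /dotA /= Re_dot_i fZ => h2; move: h1; rewrite /rdotA /dotA /=.
move: h2; case: (f h) => u v /=; case: (dot h z) => u' v' /= h2 ->.
by congr Complex; lra.
Qed.

(** For [m] in [M] close to [x], |g x| = |g (x - m)| <= |K| |x - m|. *)
Lemma eq0_on_closure (M : set H) (g : H -> R[i]) (K : R) :
  (forall x y, g (x - y) = g x - g y) ->
  (forall x, `|g x| <= (K * nrm x)%:C) ->
  (forall x, M x -> g x = 0) -> forall x, closure M x -> g x = 0.
Proof.
move=> gB gK g0 x /(hilbert_closureP hH) cx.
have [t gt] : exists t : R, `|g x| = t%:C by rewrite normc_def; eexists.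
have t0 : 0 <= t by rewrite -ler0c -gt.
apply: normr0_eq0; rewrite gt; congr (_%:C).
apply: (@eq0_le_eps _ `|K|) => e e0; rewrite ger0_norm//.
have [m Mm hm] := cx _ e0.
have := gK (x - m); rewrite gB (g0 m)// subr0 gt lecR => /le_trans; apply.
apply: (@le_trans _ _ (`|K| * nrm (x - m))).
  by rewrite ler_wpM2r ?semi_norm_ge0// ler_norm.
by rewrite mulrC ler_wpM2r// ltW.
Qed.

(** Multiplying [x] by the conjugate of [z] turns the product into the real number |z|^2, where the
    real inequality applies. *)
Lemma dot_CauchySchwarz x y : `|dot x y| <= (nrm x * nrm y)%:C.
Proof.
set z := dot x y; have [->|z0] := eqVneq z 0.
  by rewrite normr0 ler0c mulr_ge0 ?semi_norm_ge0.
have zpos : 0 < `|z| by rewrite normr_gt0.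
rewrite -(ler_pM2l zpos) -expr2.
have -> : `|z| ^+ 2 = (rdot (z^*%C *: x) y)%:C.
  rewrite -add_Re2_Im2; congr (_%:C).
  rewrite /rdotA /dotA linearZl_LR /= -/z.
  by case: (z) => a b /=; ring.
apply: (@le_trans _ _ (nrm (z^*%C *: x) * nrm y)%:C).
  by rewrite lecR ler_si.
rewrite rmorphM /= -(hilbert_norm hH) normrZ normcJ.
by rewrite (hilbert_norm hH) rmorphM mulrA.
Qed.

(* For [M] the whole space this is the adjoint; in general it is the adjoint
   followed by the orthogonal projection onto the closure of [M]. *)
Lemma relative_adjoint (M : set H) (T : H -> H) : M 0 ->
  (forall x y, M x -> M y -> M (x + y)) ->
  (forall (a : R[i]) x, M x -> M (a *: x)) ->
  bounded_operator T ->
  exists X : H -> H, [/\ bounded_operator X, range X `<=` closure M &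
    forall h y, M h -> dot (T h) y = dot h (X y)].
Proof.
move=> M0 MD MZ bT; have [C C0 hC] := hilbert_boundedP hH bT.
have Tlin : linear T := bT.1.
have /choice[X hX] y :
    exists z, closure M z /\ forall h, M h -> dot (T h) y = dot h z.
  have [|||z cz hz] := @riesz M (fun h => dot (T h) y) (C * nrm y) M0 MD MZ.
  - by move=> a b; rewrite linear_funD// linearDl.
  - by move=> a b; rewrite linear_funZ// linearZl_LR.
  - move=> x; apply: le_trans (ler_si rsi (T x) y) _.
    by rewrite mulrAC ler_wpM2r ?semi_norm_ge0.
  by exists z.
have dotB x y z : dot (x - y) z = dot x z - dot y z by rewrite linearBl.
have zero_on v : (forall h, M h -> dot h v = 0) ->
    forall x, closure M x -> dot x v = 0.
  move=> hv; apply: (@eq0_on_closure _ _ (nrm v)) hv; first by move=> *; exact: dotB.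
  by move=> x; rewrite mulrC dot_CauchySchwarz.
have Xadj x y : closure M x -> dot (T x) y = dot x (X y).
  move=> cx; apply/eqP; rewrite -subr_eq0; apply/eqP.
  apply: (@eq0_on_closure M (fun x => dot (T x) y - dot x (X y))
     (C * nrm y + nrm (X y))) x cx => [a b|a|a Ma].
  - by rewrite linear_funD// linear_funN// !dotB; ring.
  - apply: le_trans (ler_normB _ _) _.
    rewrite mulrDl rmorphD lerD//=.
      apply: le_trans (dot_CauchySchwarz _ _) _; rewrite lecR mulrAC.
      by rewrite ler_wpM2r ?semi_norm_ge0.
    by rewrite mulrC dot_CauchySchwarz.
  - by rewrite (hX y).2// subrr.
exists X; split=> [|_ [y _ <-]|h y Mh]; [|exact: (hX y).1|exact: (hX y).2].
apply: (@hilbert_bounded _ _ _ hH _ C) => [a x y|y].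
  (* The defect [v] is orthogonal to the closure of [M], which contains each of the three values of
     [X] that compose it; so [dot v v = 0]. *)
  pose v := X (a *: x + y) - (a *: X x + X y).
  have vM h : M h -> dot h v = 0.
    move=> Mh; rewrite /v linearBr linearDr linearZr_LR /=.
    by rewrite -!(hX _).2// linearDr linearZr_LR subrr.
  have vc u : closure M u -> dot u v = 0 by exact: zero_on.
  have : dot v v = 0.
    rewrite {1}/v dotB linearDl linearZl_LR /=.
    by rewrite !vc ?mulr0 ?addr0 ?subr0//; exact: (hX _).1.
  by move/eqP; rewrite dnorm_eq0 subr_eq0 => /eqP.
have [->|s0] := eqVneq (nrm (X y)) 0; first by rewrite mulr_ge0// semi_norm_ge0.
have spos : 0 < nrm (X y) by rewrite lt_def s0 semi_norm_ge0.
(* As [X y] lies in the closure of [M], |X y|^2 = Re <T (X y), y> <= C |X y| |y|. *)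
rewrite -(ler_pM2l spos) -expr2 (sqr_semi_norm rsi).
have -> : rdot (X y) (X y) = rdot (T (X y)) y.
  by rewrite /rdotA /dotA /= Xadj//; exact: (hX y).1.
apply: le_trans (ler_si rsi _ _) _; rewrite mulrA ler_wpM2r ?semi_norm_ge0//.
by rewrite mulrC hC.
Qed.

End Riesz.

(** * Bounded operators, [sharp], and finiteness of the A-seminorm *)

Section SharpOperator.
Context (R : realType) (H : completeNormedModType R[i]).
Context (dot : {dot H for conjC}) (hH : is_hilbert dot).

Local Notation hnorm := (semi_norm (rdotA dot idfun)).

Let rsi : real_semi_inner (rdotA dot idfun) := rdot_semi_inner dot.

Lemma bounded_operatorD (S T : H -> H) :
  bounded_operator S -> bounded_operator T -> bounded_operator (S + T).
Proof.
move=> bS bT; have [K _ hK] := hilbert_boundedP hH bS.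
have [L _ hL] := hilbert_boundedP hH bT.
apply: (@hilbert_bounded _ _ _ hH _ (K + L)) => [a x y|x].
  by rewrite !addrfctE bS.1 bT.1 scalerDr addrACA.
by rewrite addrfctE mulrDl (le_trans (ler_semi_normD rsi _ _))// lerD.
Qed.

Lemma bounded_operatorZ (a : R[i]) (T : H -> H) :
  bounded_operator T -> bounded_operator (a *: T).
Proof.
move=> [Tlin [K hK]]; split=> [b x y|].
  by rewrite !scalrfctE Tlin scalerDr !scalerA mulrC.
exists (complex.Re `|a| * K) => x.
rewrite scalrfctE normrZ rmorphM /= -mulrA.
have -> : (complex.Re `|a|)%:C = `|a| by rewrite normc_def.
by rewrite ler_wpM2l.
Qed.

Lemma bounded_operatorB (S T : H -> H) :
  bounded_operator S -> bounded_operator T -> bounded_operator (S - T).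
Proof.
by move=> bS bT; rewrite -scaleN1r; apply/bounded_operatorD/bounded_operatorZ.
Qed.

Lemma bounded_operator_comp (S T : H -> H) :
  bounded_operator S -> bounded_operator T -> bounded_operator (S \o T).
Proof.
move=> bS bT; have [K K0 hK] := hilbert_boundedP hH bS.
have [L _ hL] := hilbert_boundedP hH bT.
apply: (@hilbert_bounded _ _ _ hH _ (K * L)) => [a x y|x] /=.
  by rewrite bT.1 bS.1.
by rewrite (le_trans (hK _))// -mulrA ler_wpM2l.
Qed.

Lemma adjointP (T : H -> H) : bounded_operator T ->
  bounded_operator (adjoint dot T) /\
  forall x y, dot (T x) y = dot x (adjoint dot T y).
Proof.
move=> bT; apply: (xgetPex (0 : H -> H) (P := [set S | bounded_operator S /\
  forall x y, dot (T x) y = dot x (S y)])).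
have [//|//|//|X [bX _ hX]] := @relative_adjoint _ _ _ hH setT T _ _ _ bT.
by exists X; split=> // x y; exact: hX.
Qed.

Context (A : H -> H) (hA : positive_operator dot A).

Let Alin : linear A := hA.1.1.
Let Apos : forall x, 0 <= dot (A x) x := hA.2.

Local Notation dA := (dotA dot A).
Local Notation r := (rdotA dot A).
Local Notation nA := (normA dot A).

Let asi : real_semi_inner r := rdotA_semi_inner Alin Apos.

Lemma normAE x : nA x = semi_norm r x.
Proof. by []. Qed.

Lemma dotA_selfadjoint x y : dot (A x) y = dot x (A y).
Proof. by rewrite [RHS](dotC dot (A y)) -(dotA_herm Alin Apos y x). Qed.

Lemma sharpP (T : H -> H) : in_BA dot A T ->
  bounded_operator (sharp dot A T) /\
  forall x y, dA (T x) y = dA x (sharp dot A T y).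
Proof.
move=> [bT [S [bS AS]]].
have [bTs hTs] := adjointP bT; have [bSs hSs] := adjointP bS.
have [bX AX _] : [set X : H -> H | [/\ bounded_operator X,
    A \o X = adjoint dot T \o A & range X `<=` closure (range A)]]
    (sharp dot A T).
  apply: xgetPex.
  (* The relative adjoint of S^* on the range of [A] satisfies <A h, X y> = <S^* A h, y> = <A h, S
     y>, whence A X = A S. *)
  have [||||X [bX cX hX]] := @relative_adjoint _ _ _ hH (range A) (adjoint dot S).
  - by exists 0 => //; rewrite linear_fun0.
  - by move=> _ _ [x _ <-] [y _ <-]; exists (x + y) => //; rewrite linear_funD.
  - by move=> a _ [x _ <-]; exists (a *: x) => //; rewrite linear_funZ.
  - exact: bSs.
  exists X; split=> //; rewrite -AS; apply/funext => y /=.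
  apply: (@dot_injl _ _ dot) => h; rewrite -!dotA_selfadjoint -hX; last by exists h.
  by rewrite dotC -hSs -dotC.
split=> // x y; rewrite /dotA dotA_selfadjoint hTs.
by rewrite -[adjoint _ _ _]/((adjoint dot T \o A) y) -AX /= dotA_selfadjoint.
Qed.

(** With [K] and [L] bounding [S] and [A], |S^n x|_A <= sqrt L |S^n x| <= sqrt L K^n |x|; growth of
    iterates then gives |S x|_A <= K on unit vectors. This makes the supremum in [opnormA]
    finite. *)
Lemma A_selfadjoint_bounded (S : H -> H) : bounded_operator S ->
  si_selfadjoint r S -> exists K, forall x, nA x = 1 -> nA (S x) <= K.
Proof.
move=> bS hS; have [K K0 hK] := hilbert_boundedP hH bS.
have [L L0 hL] := hilbert_boundedP hH hA.1.
exists K => x; apply: (selfadjoint_iter_bound asi hS K0) => {}x.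
exists (Num.sqrt L * hnorm x) => n.
have iterK : hnorm (iter n S x) <= K ^+ n * hnorm x.
  elim: n => [|n IH]; first by rewrite expr0 mul1r.
  by rewrite iterS exprS -mulrA (le_trans (hK _))// ler_wpM2l.
apply: (@le_trans _ _ (Num.sqrt L * hnorm (iter n S x))); last first.
  by rewrite -mulrA (mulrC (hnorm x)) ler_wpM2l ?sqrtr_ge0.
move: (iter n S x) => y.
rewrite -ler_sqr ?nnegrE ?mulr_ge0 ?sqrtr_ge0 ?semi_norm_ge0//.
rewrite (sqr_semi_norm asi) exprMn sqr_sqrtr// expr2 mulrA.
apply: le_trans (ler_si rsi (A y) y) _.
by rewrite ler_wpM2r ?semi_norm_ge0.
Qed.

Lemma opnormA_le (S : H -> H) (k : R) x1 : nA x1 = 1 ->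
  (forall x, nA x = 1 -> nA (S x) <= k) -> opnormA dot A S <= k.
Proof.
move=> x1_unit hk; apply: ge_sup; first by exists (nA (S x1)); exists x1.
by move=> _ [x hx <-]; exact: hk.
Qed.

Lemma le_opnormA (S : H -> H) x : bounded_operator S -> si_selfadjoint r S ->
  nA x = 1 -> nA (S x) <= opnormA dot A S.
Proof.
move=> bS hS hx; have [K hK] := A_selfadjoint_bounded bS hS.
apply: ub_le_sup; last by exists x.
by exists K => _ [y hy <-]; exact: hK.
Qed.

(** Without unit vectors, rescaling shows that the seminorm vanishes; Cauchy-Schwarz then kills the
    whole form, hence [A]. *)
Lemma exists_normA1 : A <> 0 -> exists x, nA x = 1.
Proof.
move=> A0; apply: contrapT => /forallNP nounit; apply: A0.
have r0 x : r x x = 0.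
  rewrite -(sqr_semi_norm asi); apply/eqP; rewrite sqrf_eq0; apply/negP => /negP n0.
  apply: (nounit ((nA x)^-1%:C *: x)); rewrite !normAE.
  by rewrite (semi_normZ asi) ger0_norm ?invr_ge0 ?semi_norm_ge0// mulVf.
have rxy x y : r x y = 0.
  have := ler_abs_si asi x y.
  by rewrite /semi_norm r0 sqrtr0 mul0r normr_le0 => /eqP.
apply/funext => x; apply: (@dot_injl _ _ dot) => h; rewrite linear0r dotC.
rewrite -[dot _ _]/(dA x h) (complexE (dA x h)) (Im_dotA dot A).
by rewrite -/(r x h) !rxy mulr0 addr0 conjc0.
Qed.

(** * A-real and A-imaginary parts of [T], and its A-numerical radius *)

Section CartesianDecomposition.
Context (T : H -> H) (hT : in_BA dot A T).

Local Notation X := (sharp dot A T).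
Local Notation P := (ReA dot A T).
Local Notation Q := (ImA dot A T).

Let bT : bounded_operator T := hT.1.
Let bX : bounded_operator X := (sharpP hT).1.

Lemma rdotA_sharp x y : r (T x) y = r x (X y).
Proof. by rewrite /rdotA (sharpP hT).2. Qed.

Lemma rdotA_sharpl x y : r (X x) y = r x (T y).
Proof. by rewrite (siC asi) -rdotA_sharp (siC asi). Qed.

Lemma Im_sharpl x : complex.Im (dA (X x) x) = - complex.Im (dA (T x) x).
Proof.
rewrite (sharpP hT).2 (dotA_herm Alin Apos (X x)).
by case: (dA (X x) x) => a b /=; rewrite opprK.
Qed.

Lemma ReA_E x : P x = (2^-1)%:C *: (T x + X x).
Proof. by rewrite fmorphV rmorph_nat. Qed.

(** Since 1 / (2i) = - i / 2, a real scalar can be pulled out, as the lemmas on real forms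
    require. *)
Lemma ImA_E x : Q x = (- 2^-1)%:C *: ('i%C *: (T x - X x)).
Proof.
rewrite scalerA /ImA scalrfctE; congr (_ *: _).
rewrite invfM -[RHS]mulr1 -[in RHS](@mulfV _ 'i%C) ?neq0Ci// mulrA.
rewrite -[_ * 'i%C * 'i%C]mulrA -expr2 sqr_i mulrN1 rmorphN opprK.
by rewrite fmorphV rmorph_nat.
Qed.

Lemma bounded_ReA : bounded_operator P.
Proof. by apply: bounded_operatorZ; exact: bounded_operatorD. Qed.

Lemma bounded_ImA : bounded_operator Q.
Proof. by apply: bounded_operatorZ; exact: bounded_operatorB. Qed.

Lemma ReA_selfadjoint : si_selfadjoint r P.
Proof.
move=> x y; rewrite !ReA_E (siZl asi) (siZr asi) (siDl asi) (siDr asi).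
by rewrite rdotA_sharp rdotA_sharpl addrC.
Qed.

Lemma rdotA_il x y : r ('i%C *: x) y = - r x ('i%C *: y).
Proof.
rewrite /rdotA dotAZl// dotAZr//; case: (dA x y) => a b /=; ring.
Qed.

Lemma rdotA_ir x y : r ('i%C *: x) ('i%C *: y) = r x y.
Proof.
by rewrite rdotA_il scalerA -expr2 sqr_i scaleN1r (siNr asi) opprK.
Qed.

(** Multiplication by i and [T - X] are both skew for [r] and commute. *)
Lemma ImA_selfadjoint : si_selfadjoint r Q.
Proof.
move=> x y; rewrite !ImA_E (siZl asi) (siZr asi) rdotA_il.
rewrite !scalerBr (siDl asi) (siDr asi) (siNl asi) (siNr asi).
rewrite rdotA_sharp rdotA_sharpl -(linear_funZ _ _ bT.1) -(linear_funZ _ _ bX.1).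
by rewrite -rdotA_sharp -rdotA_sharpl; ring.
Qed.

Lemma rdotA_ReA x : r (T x) x = r (P x) x.
Proof.
by rewrite ReA_E (siZl asi) (siDl asi) rdotA_sharpl (siC asi x); lra.
Qed.

Lemma Im_dotA_ImA x : complex.Im (dA (T x) x) = r (Q x) x.
Proof.
rewrite ImA_E (siZl asi) rdotA_il -(Im_dotA dot A) dotADl// dotANl//.
by rewrite raddfB /= Im_sharpl; lra.
Qed.

Lemma sqr_abs_dotA x :
  complex.Re `|dA (T x) x| ^+ 2 = r (P x) x ^+ 2 + r (Q x) x ^+ 2.
Proof.
rewrite -rdotA_ReA -Im_dotA_ImA normc_def /= sqr_sqrtr//.
by rewrite addr_ge0 ?sqr_ge0.
Qed.

(* [P^2 + Q^2 = (T X + X T) / 2], evaluated as quadratic forms. *)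
Lemma rdotA_anticommutator x :
  r (((T \o X) + (X \o T)) x) x = 2 * (nA (P x) ^+ 2 + nA (Q x) ^+ 2).
Proof.
rewrite !normAE !(sqr_semi_norm asi) ReA_E ImA_E.
rewrite !(siZl asi, siZr asi) rdotA_ir.
(* The quadratic form becomes |X x|_A^2 + |T x|_A^2; the parallelogram law for [T x] and [X x]
   finishes, i being isometric. *)
have -> : r (((T \o X) + (X \o T)) x) x = r (X x) (X x) + r (T x) (T x).
  by rewrite addrfctE (siDl asi) (rdotA_sharp (X x)) (rdotA_sharpl (T x)).
by rewrite !(siE asi) (siC asi (X x) (T x)); lra.
Qed.

Lemma cartesian_parallelogram x :
  nA ((P + Q) x) ^+ 2 + nA ((P - Q) x) ^+ 2 =
  2 * (nA (P x) ^+ 2 + nA (Q x) ^+ 2).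
Proof.
rewrite !normAE !(sqr_semi_norm asi) !addrfctE opprfctE.
by rewrite !(siE asi) (siC asi (Q x) (P x)); lra.
Qed.

Lemma selfadjointA_add (S S' : H -> H) : si_selfadjoint r S ->
  si_selfadjoint r S' -> si_selfadjoint r (S + S').
Proof.
by move=> hS hS' x y; rewrite !addrfctE (siDl asi) (siDr asi) hS hS'.
Qed.

Lemma selfadjointA_sub (S S' : H -> H) : si_selfadjoint r S ->
  si_selfadjoint r S' -> si_selfadjoint r (S - S').
Proof.
move=> hS hS' x y; rewrite !addrfctE !opprfctE !(siE asi); by rewrite hS hS'.
Qed.

Local Notation Z := ((T \o X) + (X \o T)).

Lemma bounded_anticommutator : bounded_operator Z.
Proof. by apply: bounded_operatorD; exact: bounded_operator_comp. Qed.

Lemma anticommutator_selfadjoint : si_selfadjoint r Z.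
Proof.
by move=> x y; rewrite !addrfctE /= !(siE asi) !(rdotA_sharp, rdotA_sharpl).
Qed.

(** The left side is at most |P x|_A^2 + |Q x|_A^2 = r (Z x) x / 2, and Cauchy-Schwarz bounds
    [r (Z x) x]. *)
Lemma sqr_abs_dotA_le x : nA x = 1 ->
  complex.Re `|dA (T x) x| ^+ 2 <= 2^-1 * nA (Z x).
Proof.
move=> x1; rewrite sqr_abs_dotA.
have h S : r (S x) x ^+ 2 <= nA (S x) ^+ 2.
  rewrite -[leLHS]real_normK ?num_real// ler_sqr ?nnegrE ?sqrtr_ge0//.
  by have := ler_abs_si asi (S x) x; rewrite -!normAE x1 mulr1.
have := ler_si asi (Z x) x; rewrite -!normAE x1 mulr1 rdotA_anticommutator.
by have := h P; have := h Q; lra.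
Qed.

Lemma Re_norm_ge0 (z : R[i]) : 0 <= complex.Re `|z|.
Proof. by rewrite normc_def; exact: sqrtr_ge0. Qed.

Lemma numradiusA_le (k : R) x1 : nA x1 = 1 -> 0 <= k ->
  (forall x, nA x = 1 -> complex.Re `|dA (T x) x| ^+ 2 <= k) ->
  numradiusA dot A T ^+ 2 <= k.
Proof.
move=> hx1 k0 hk; have s0 := sqrtr_ge0 k.
have h x : nA x = 1 -> complex.Re `|dA (T x) x| <= Num.sqrt k.
  by move=> /hk hx; rewrite -ler_sqr ?nnegrE ?Re_norm_ge0// sqr_sqrtr.
have w0 : 0 <= numradiusA dot A T.
  apply: le_trans (Re_norm_ge0 (dA (T x1) x1)) _.
  apply: ub_le_sup; last by exists x1.
  by exists (Num.sqrt k) => _ [x hx <-]; exact: h.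
rewrite -(sqr_sqrtr k0) ler_sqr ?nnegrE//; apply: ge_sup.
  by exists (complex.Re `|dA (T x1) x1|); exists x1.
by move=> _ [x hx <-]; exact: h.
Qed.

(** The supremum is finite although [T] need not be A-selfadjoint: the squared values are controlled
    by [Z], which is. *)
Lemma le_numradiusA x : nA x = 1 ->
  complex.Re `|dA (T x) x| <= numradiusA dot A T.
Proof.
move=> hx; have [K hK] :=
  A_selfadjoint_bounded bounded_anticommutator anticommutator_selfadjoint.
apply: ub_le_sup; last by exists x.
exists (Num.sqrt (2^-1 * K)) => _ [y hy <-].
have K0 : 0 <= K by apply: le_trans (hK y hy); exact: sqrtr_ge0.
rewrite -ler_sqr ?nnegrE ?Re_norm_ge0 ?sqrtr_ge0// sqr_sqrtr ?mulr_ge0//.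
by apply: le_trans (sqr_abs_dotA_le hy) _; rewrite ler_wpM2l// hK.
Qed.

End CartesianDecomposition.

End SharpOperator.

Theorem corollary2p9 (R : realType) (H : completeNormedModType R[i])
    (dot : {dot H for conjC}) (hH : is_hilbert dot)
    (A : H -> H) (hA : positive_operator dot A) (hA0 : A <> 0)
    (T : H -> H) (hT : in_BA dot A T) :
  let nrm : (H -> H) -> R := opnormA dot A in
  let Ts : H -> H := sharp dot A T in
  let ReT : H -> H := ReA dot A T in
  let ImT : H -> H := ImA dot A T in
  let alpha : R := `|nrm (ReT + ImT) - nrm (ReT - ImT)| in
  4^-1 * nrm ((Ts \o T) + (T \o Ts)) + alpha / 2 * Num.max (nrm ReT) (nrm ImT)
    <= numradiusA dot A T ^+ 2
  /\ numradiusA dot A T ^+ 2 <= 2^-1 * nrm ((T \o Ts) + (Ts \o T)).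
Proof.
move=> nrm Ts ReT ImT alpha.
have asi := rdotA_semi_inner hA.1.1 hA.2.
have [x1 hx1] := exists_normA1 hA hA0.
have nle S k : (forall x, normA dot A x = 1 -> normA dot A (S x) <= k) -> nrm S <= k.
  by move=> hk; exact: (opnormA_le hx1 hk).
have bP : bounded_operator ReT by exact: bounded_ReA.
have bQ : bounded_operator ImT by exact: bounded_ImA.
have sP : si_selfadjoint (rdotA dot A) ReT by exact: ReA_selfadjoint.
have sQ : si_selfadjoint (rdotA dot A) ImT by exact: ImA_selfadjoint.
have bPQ := bounded_operatorD hH bP bQ; have bPQ' := bounded_operatorB hH bP bQ.
have sPQ := selfadjointA_add hA sP sQ; have sPQ' := selfadjointA_sub hA sP sQ.
have lea x : normA dot A x = 1 -> normA dot A ((ReT + ImT) x) <= nrm (ReT + ImT).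
  exact: le_opnormA.
have leb x : normA dot A x = 1 -> normA dot A ((ReT - ImT) x) <= nrm (ReT - ImT).
  exact: le_opnormA.
have leZ x : normA dot A x = 1 -> normA dot A (((T \o Ts) + (Ts \o T)) x)
    <= nrm ((T \o Ts) + (Ts \o T)).
  apply: (le_opnormA hH hA); first exact: bounded_anticommutator.
  exact: anticommutator_selfadjoint.
split; last first.
  apply: (numradiusA_le hx1) => [|x hx].
    by rewrite mulr_ge0// (le_trans _ (leZ _ hx1))// sqrtr_ge0.
  apply: le_trans (sqr_abs_dotA_le hH hA hT hx) _.
  by rewrite ler_wpM2l// leZ.
(* Both bounds now mention the same anticommutator. *)
rewrite (addrC (Ts \o T)).
set w := numradiusA dot A T; set a := nrm (ReT + ImT) in lea alpha *.
set b := nrm (ReT - ImT) in leb alpha *.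
have a0 : 0 <= a by apply: le_trans (lea _ hx1); exact: sqrtr_ge0.
have b0 : 0 <= b by apply: le_trans (leb _ hx1); exact: sqrtr_ge0.
have w0 : 0 <= w.
  by apply: le_trans (le_numradiusA hH hA hT hx1); exact: Re_norm_ge0.
have sqr2w S : (forall x, normA dot A x = 1 ->
    rdotA dot A (S x) x ^+ 2 <= 2 * w ^+ 2) ->
    si_selfadjoint (rdotA dot A) S -> nrm S <= Num.sqrt 2 * w.
  move=> hS sS; apply: nle => x; apply: (selfadjoint_norm_le asi sS) => {}x /hS hx.
  rewrite -ler_sqr ?nnegrE ?mulr_ge0 ?sqrtr_ge0// real_normK ?num_real//.
  by rewrite exprMn sqr_sqrtr.
have cart x : normA dot A x = 1 ->
    rdotA dot A (ReT x) x ^+ 2 + rdotA dot A (ImT x) x ^+ 2 <= w ^+ 2.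
  move=> hx; rewrite -(sqr_abs_dotA hH hA hT) ler_sqr ?nnegrE ?Re_norm_ge0//.
  exact: le_numradiusA.
have a2 : a ^+ 2 <= 2 * w ^+ 2.
  rewrite -[2](@sqr_sqrtr _ 2)// -exprMn ler_sqr ?nnegrE ?mulr_ge0 ?sqrtr_ge0//.
  (* Uses (p + q)^2 <= 2 (p^2 + q^2); the constant sqrt 2 comes from here. *)
  apply: sqr2w sPQ => x /cart; rewrite addrfctE (siDl asi).
  have := sqr_ge0 (rdotA dot A (ReT x) x - rdotA dot A (ImT x) x); nra.
have b2 : b ^+ 2 <= 2 * w ^+ 2.
  rewrite -[2](@sqr_sqrtr _ 2)// -exprMn ler_sqr ?nnegrE ?mulr_ge0 ?sqrtr_ge0//.
  apply: sqr2w sPQ' => x /cart; rewrite addrfctE opprfctE (siDl asi) (siNl asi).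
  have := sqr_ge0 (rdotA dot A (ReT x) x + rdotA dot A (ImT x) x); nra.
have m_le : Num.max (nrm ReT) (nrm ImT) <= (a + b) / 2.
  rewrite ge_max; apply/andP; split; apply: nle => x hx.
    apply: le_trans (semi_norm_half_sum asi (ReT x) (ImT x)) _.
    by rewrite ler_pM2r// lerD//; [exact: lea|exact: leb].
  apply: le_trans (semi_norm_half_sum asi (ImT x) (ReT x)) _.
  rewrite -opprB (semi_normN asi) (addrC (ImT x)).
  by rewrite ler_pM2r// lerD//; [exact: lea|exact: leb].
have Z_le : nrm ((T \o Ts) + (Ts \o T)) <= a ^+ 2 + b ^+ 2.
  have sZ := anticommutator_selfadjoint hH hA hT.
  apply: nle => x; apply: (selfadjoint_norm_le asi sZ) => {}x hx.
  (* The quadratic form of the anticommutator is |(P + Q) x|_A^2 + |(P - Q) x|_A^2. *)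
  rewrite (rdotA_anticommutator hH hA hT) -(cartesian_parallelogram hA).
  rewrite ger0_norm ?addr_ge0 ?sqr_ge0// lerD// ler_sqr ?nnegrE ?sqrtr_ge0//.
    exact: lea.
  exact: leb.
have alpha0 : 0 <= alpha / 2 by apply: mulr_ge0; first exact: normr_ge0.
apply: (@le_trans _ _ (4^-1 * (a ^+ 2 + b ^+ 2) + alpha / 2 * ((a + b) / 2))).
  by rewrite lerD ?ler_wpM2l.
(* As alpha (a + b) = |a^2 - b^2|, the sum is half the larger of a^2 and b^2, hence at most w^2. *)
rewrite /alpha; case: (lerP b a) => hab; rewrite -/a -/b; nra.
Qed.
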